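(* Let $N=\{1,\dots,n\}$ and let $g:\mathbb Z^n\to\mathbb R\cup\{+\infty\}$ be an L$^\natural$-convex function such that the set $\arg\min g$ of its minimizers is nonempty and bounded from below; let $p^\dagger_{\min}$ be the unique minimal minimizer of $g$. Run the algorithm L$^\natural$-convex Minimization from an initial vector $p^\circ\in\mathrm{dom}\,g$ with $p^\circ\le p^\dagger_{\min}$. If, in each iteration, the set $X$ selected in Step 2 is $(g,p)$-minimal, i.e., $X$ is nonempty and $$g(p+\chi_Y)>g(p+\chi_X)\qquad\text{for every } Y\subsetneq X,$$ then the algorithm finds $p^\dagger_{\min}$; that is, it terminates and the vector $p$ at termination equals $p^\dagger_{\min}$. Moreover, the set $X$ selected in Step 2 is $(g,p)$-minimal if (i) $X$ is a minimal (with respect to inclusion) subset of $N$ satisfying $g(p+\chi_X)<g(p)$, or (ii) $X$ is the unique minimal (with respect to inclusion) minimizer of $g(p+\chi_X)-g(p)$ over the subsets $X$ of $N$.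
   Context: For $g:\mathbb Z^n\to\mathbb R\cup\{+\infty\}$, $\mathrm{dom}\,g=\{p\in\mathbb Z^n\mid g(p)<+\infty\}$. For $p,q\in\mathbb Z^n$, $p\wedge q$ and $p\vee q$ are the componentwise minimum and maximum, and $\mathbf 1=(1,\dots,1)$. The function $g$ is L$^\natural$-convex if for all $p,q\in\mathrm{dom}\,g$ and all nonnegative integers $\lambda$, $$g(p)+g(q)\ge g((p+\lambda\mathbf 1)\wedge q)+g(p\vee(q-\lambda\mathbf 1)).$$ When $\arg\min g$ is nonempty and bounded from below, it has a unique minimal element (componentwise order), denoted $p^\dagger_{\min}$. For $X\subseteq N$, $\chi_X\in\{0,1\}^n$ is the characteristic vector of $X$. Algorithm L$^\natural$-convex Minimization. Step 0: Set $p:=p^\circ$, where $p^\circ\in\mathrm{dom}\,g$ satisfies $p^\circ\le p^\dagger_{\min}$. Step 1: If $g(p+\chi_X)\ge g(p)$ for all $X\subseteq N$, then stop. Step 2: Find a set $X\subseteq N$ such that $g(p+\chi_X)<g(p)$. Step 3: Set $p:=p+\chi_X$ and go to Step 1. *)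

(* Defs.v *)
From mathcomp Require Import all_boot all_order all_algebra.
From mathcomp Require Import boolp classical_sets functions reals ereal.

Set Implicit Arguments.
Unset Strict Implicit.
Unset Printing Implicit Defensive.

Import Order.TTheory GRing.Theory Num.Theory.

Local Open Scope classical_set_scope.
Local Open Scope ring_scope.

(* Z^n is the function type 'I_n -> int: its group structure and its lattice
   order (<=, `&`, `|` in %O) are the componentwise ones, from functions.v and
   boolp.v.  Functions with values in R U {+oo} are maps to \bar R that are
   assumed never to take the value -oo. *)
Notation intvec n := ('I_n -> int).

Definition chi (n : nat) (X : {set 'I_n}) : intvec n :=
  fun i => (i \in X)%:Z.

Definition minimal_in (d : Order.disp_t) (T : porderType d) (A : set T) (x : T)
    : Prop :=
  A x /\ forall y, A y -> (y <= x)%O -> y = x.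

Section Lnatural.
Variables (R : realType) (n : nat) (g : intvec n -> \bar R).

Definition dom : set (intvec n) := [set p | (g p < +oo)%E].

Definition argmin : set (intvec n) := [set p | forall q, (g p <= g q)%E].

Definition Lnat_convex : Prop :=
  forall (p q : intvec n) (l : nat), dom p -> dom q ->
    (g ((p + cst l%:Z)%R `&` q)%O + g (p `|` (q - cst l%:Z)%R)%O <= g p + g q)%E.

Definition stops (p : intvec n) : bool :=
  [forall X : {set 'I_n}, (g p <= g (p + chi X)%R)%E].

Definition descends (p : intvec n) (X : {set 'I_n}) : bool :=
  (g (p + chi X)%R < g p)%E.

(* The sequences p and X record the current vector and the set chosen in each
   iteration; the choice may depend on the whole history.  A terminated run is
   padded by repeating the final vector, with irrelevant further sets.  Since
   a set X with [descends p X] exists whenever [stops p] fails, a run never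
   gets stuck, so these infinite sequences represent all maximal runs. *)
Definition algorithm_run (p0 : intvec n) (p : nat -> intvec n)
    (X : nat -> {set 'I_n}) : Prop :=
  p 0%N = p0 /\
  forall k, if stops (p k) then p k.+1 = p k
            else descends (p k) (X k) /\ p k.+1 = p k + chi (X k).

Definition gp_minimal (p : intvec n) (X : {set 'I_n}) : Prop :=
  X != finset.set0 /\
  forall Y : {set 'I_n}, Y \proper X -> (g (p + chi X)%R < g (p + chi Y)%R)%E.

Definition minimizes_increment (p : intvec n) (X : {set 'I_n}) : bool :=
  [forall Y : {set 'I_n}, (g (p + chi X)%R - g p <= g (p + chi Y)%R - g p)%E].

End Lnatural.

(* Main.v *)
Require Import Defs.
From mathcomp Require Import all_boot all_order all_algebra.
From mathcomp Require Import boolp classical_sets functions reals ereal.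
From mathcomp Require Import zify.

Import Order.TTheory GRing.Theory Num.Theory.

(** Let q be the minimal minimizer.  Everything follows from two applications
    of the translation submodularity inequality to a pair (p', q).

    A current vector p in the domain that is not above q cannot be a stopping
    point ([stops_ge]).  Let A be the set of indices where q - p attains its
    maximum, and take lambda to be that maximum minus 1.  Then the inequality
    reads g(q - chi_A) + g(p + chi_A) <= g(p) + g(q); since q - chi_A lies
    strictly below q, it is not a minimizer, and so g(p + chi_A) < g(p).

    Conversely, if p <= q, then adding a (g,p)-minimal set X never overshoots
    q ([gp_minimal_step_le]).  Submodularity (lambda = 0) for p + chi_X and q
    gives g(p + chi_Y) <= g(p + chi_X), where Y collects the indices of X at
    which p is strictly below q; minimality of X forces Y = X.

    Hence all iterates stay in the domain and below q, so that stopping means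
    reaching q, and every iteration raises the sum of the components by at
    least 1 while that sum is bounded by the one of q ([run_invariant]).

    For the two selection rules, a proper subset Y of X violating
    (g,p)-minimality would be a smaller descent set, respectively a smaller
    minimizer of the increment, against the minimality of X. *)

Local Open Scope classical_set_scope.
Local Open Scope ring_scope.

Lemma chi_set0 (n : nat) : chi finset.set0 = 0 :> ('I_n -> int).
Proof. by apply/funext => i; rewrite /chi finset.inE. Qed.

Lemma sum_chi (n : nat) (X : {set 'I_n}) : \sum_i chi X i = #|X|%:Z.
Proof.
rewrite -sum1_card -natz natr_sum [RHS]big_mkcond /=.
by apply: eq_bigr => i _; rewrite /chi; case: (i \in X).
Qed.

Section LnatConvex.
Variables (R : realType) (n : nat) (g : ('I_n -> int) -> \bar R).
Hypothesis g_gtNy : forall p, g p != -oo%E.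

Implicit Types (p q : 'I_n -> int) (X Y : {set 'I_n}).

Lemma dom_fin_num {p} : dom g p -> g p \is a fin_num.
Proof. by rewrite /dom /= fin_numE g_gtNy ltey. Qed.

Lemma argmin_dom {p q} : dom g p -> argmin g q -> dom g q.
Proof. by rewrite /dom /= => pd qmin; apply: le_lt_trans (qmin p) pd. Qed.

Lemma descends_neq0 {p X} : descends g p X -> X != finset.set0.
Proof.
apply: contraTneq => ->.
by rewrite /descends chi_set0 addr0 ltxx.
Qed.

Lemma minset_descends_gp_minimal {p X} :
  minset (descends g p) X -> gp_minimal g p X.
Proof.
move=> /minsetP[Xdesc Xmin]; split; first exact: descends_neq0 Xdesc.
move=> Y YX; apply: (lt_le_trans Xdesc).
rewrite leNgt; apply/negP => Ydesc.
by have := YX; rewrite (Xmin Y Ydesc (proper_sub YX)) fintype.properxx.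
Qed.

(** A proper subset Y with g(p + chi_Y) <= g(p + chi_X) would itself minimize
    the increment; subtracting g(p) preserves this comparison because g(p) is
    finite. *)
Lemma minset_minimizes_gp_minimal {p X} : dom g p -> descends g p X ->
  minset (minimizes_increment g p) X -> gp_minimal g p X.
Proof.
move=> pd Xdesc /minsetP[/forallP Xopt Xmin].
split; first exact: descends_neq0 Xdesc.
move=> Y YX; rewrite ltNge; apply/negP => leYX.
have Yopt : minimizes_increment g p Y.
  apply/forallP => Z; apply: le_trans (Xopt Z).
  by rewrite leeD2rE // fin_numN dom_fin_num.
by have := YX; rewrite (Xmin Y Yopt (proper_sub YX)) fintype.properxx.
Qed.

Hypothesis g_Lnat : Lnat_convex g.

(** If q exceeds p somewhere, then raising p by one and lowering q by one where
    q - p is largest strictly increases g at q, hence strictly decreases g at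
    p. *)
Lemma stops_ge {p q} : dom g p -> minimal_in (argmin g) q -> stops g p ->
  (q <= p)%O.
Proof.
move=> pd [qopt qmin] /forallP pstop; apply/lefP => i0; rewrite leNgt.
apply/negP => lti0.
have qd := argmin_dom pd qopt.
have [m _ mmax] := @arg_maxP _ int 'I_n i0 xpredT (fun i => q i - p i) isT.
(* This choice of lambda makes clipping at distance lambda move p and q only
   where q - p attains its maximum, and there by exactly one. *)
pose l := absz (q m - p m - 1)%R.
have lE : l%:Z = q m - p m - 1.
  by have /= := mmax i0 isT; rewrite /l; lia.
pose A := finset.finset (fun i => q i - p i == q m - p m).
have mA : m \in A by rewrite finset.inE.
have lowE : ((p + cst l%:Z) `&` q)%O = q - chi A.
  apply/funext => i; rewrite meetfE !fctE /chi finset.inE lE meetEtotal.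
  have /= := mmax i isT; case: leP; case: eqP => /=; lia.
have upE : (p `|` (q - cst l%:Z))%O = p + chi A.
  apply/funext => i; rewrite joinfE !fctE /chi finset.inE lE joinEtotal.
  have /= := mmax i isT; case: leP; case: eqP => /=; lia.
(* The shifted q is not a minimizer, which contradicts translation
   submodularity once g does not decrease at p. *)
have := g_Lnat _ _ l pd qd; rewrite lowE upE.
apply/negP; rewrite -ltNge addeC; apply: lte_leD => //.
  exact: dom_fin_num.
rewrite lt_neqAle qopt andbT; apply/eqP => eqg.
have /qmin : argmin g (q - chi A) by move=> r; rewrite -eqg; apply: qopt.
have -> : ((q - chi A)%R <= q)%O.
  by apply/lefP => i; rewrite !fctE /chi; case: (i \in A); lia.
by move=> /(_ isT)/(congr1 (@^~ m)); rewrite !fctE /chi mA; lia.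
Qed.

(** Cutting p + chi X back to q amounts to dropping from X the indices where p
    already equals q.  Since joining with q cannot improve on the minimizer q,
    submodularity says that this cut does not increase g, so a (g,p)-minimal X
    has no such index. *)
Lemma gp_minimal_step_le {p q X} : dom g (p + chi X) -> argmin g q ->
  (p <= q)%O -> gp_minimal g p X -> (p + chi X <= q)%O.
Proof.
move=> pXd qopt /lefP pq [_ Xmin].
have qd := argmin_dom pXd qopt.
pose Y := finset.finset (fun i => (i \in X) && (p i < q i)).
have YX : Y \subset X by apply/fintype.subsetP => i; rewrite finset.inE => /andP[].
have meetE : ((p + chi X + cst 0%:Z) `&` q)%O = p + chi Y.
  apply/funext => i; rewrite meetfE !fctE /chi finset.inE meetEtotal.
  by have := pq i; case: (i \in X); case: ltgtP => /=; case: leP; lia.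
(* The other term of the inequality is at least g q, by optimality of q. *)
have leYX : (g (p + chi Y)%R <= g (p + chi X)%R)%E.
  have qfin := dom_fin_num qd.
  rewrite -(leeD2rE _ _ qfin); apply: le_trans (g_Lnat _ _ 0%N pXd qd).
  by rewrite meetE leeD2l.
have XY : X \subset Y.
  apply/negPn/negP => XnY; have := Xmin Y.
  by rewrite properE YX XnY ltNge leYX => /(_ isT).
apply/lefP => i; rewrite !fctE /chi.
have := pq i; have := fintype.subsetP XY i; rewrite finset.inE.
by case: (i \in X) => /= [/(_ isT)|_]; lia.
Qed.

(** The sum of the components serves as a progress measure: a (g,p)-minimal
    set is nonempty, so it grows with each iteration. *)
Lemma run_invariant {q p0} {p : nat -> 'I_n -> int} {X : nat -> {set 'I_n}} k :
  argmin g q -> dom g p0 -> (p0 <= q)%O -> algorithm_run g p0 p X ->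
  (forall j, ~~ stops g (p j) -> gp_minimal g (p j) (X j)) ->
  (forall j, (j < k)%N -> ~~ stops g (p j)) ->
  [/\ dom g (p k), (p k <= q)%O & \sum_i p0 i + k%:Z <= \sum_i p k i].
Proof.
move=> qopt p0d p0q [p_0 p_S] Xmin.
elim: k => [_|k IHk nstop]; first by rewrite p_0 addr0.
have [|pd pq sum_ge] := IHk; first by move=> j /ltnW; apply: nstop.
have := p_S k; rewrite (negPf (nstop k (ltnSn k))) => -[Xdesc ->].
have Xk := Xmin k (nstop k (ltnSn k)).
have pXd : dom g (p k + chi (X k)) by apply: lt_trans Xdesc pd.
split=> //; first exact: gp_minimal_step_le.
have -> : \sum_i (p k + chi (X k)) i = \sum_i p k i + #|X k|%:Z.
  by rewrite -sum_chi -big_split.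
have : (0 < #|X k|)%N by rewrite card_gt0; case: Xk.
lia.
Qed.

End LnatConvex.

Theorem theorem5p1 (R : realType) (n : nat) (g : ('I_n -> int) -> \bar R)
  (g_gtNy : forall p, g p != -oo%E)
  (g_Lnat : Lnat_convex g)
  (argmin_neq0 : argmin g !=set0)
  (argmin_lb : has_lbound (argmin g))
  (pmin : 'I_n -> int)
  (pminP : unique (minimal_in (argmin g)) pmin) :
  (forall (p0 : 'I_n -> int) (p : nat -> 'I_n -> int) (X : nat -> {set 'I_n}),
     dom g p0 -> (p0 <= pmin)%O ->
     algorithm_run g p0 p X ->
     (forall k, ~~ stops g (p k) -> gp_minimal g (p k) (X k)) ->
     exists k, [/\ forall j, (j < k)%N -> ~~ stops g (p j),
                   stops g (p k)
                 & p k = pmin])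
  /\
  (forall (p : 'I_n -> int) (X : {set 'I_n}),
     dom g p -> descends g p X ->
     minset (descends g p) X \/
     unique (fun Z : {set 'I_n} => minset (minimizes_increment g p) Z) X ->
     gp_minimal g p X).
Proof.
have [[qopt qmin] _] := pminP.
split=> [p0 p X p0d p0q run Xmin|p X pd Xdesc [|[Xopt _]]]; last 2 first.
- exact: minset_descends_gp_minimal.
- exact: minset_minimizes_gp_minimal.
have [k pk] : exists k, stops g (p k).
  apply: contrapT => /forallNP nstop.
  (* After this many iterations the sum of the components exceeds that of
     pmin. *)
  pose k := (absz (\sum_i pmin i - \sum_i p0 i)%R).+1.
  have [|_ /lefP pq] := run_invariant _ _ _ g_gtNy g_Lnat k qopt p0d p0q run Xmin.
    by move=> j _; apply/negP/nstop.
  have : \sum_i p k i <= \sum_i pmin i by apply: ler_sum.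
  rewrite /k; lia.
(* Past its first stopping point a run is constant, so only the least index
   gives the number of iterations. *)
have [m pm m_le] := ex_minnP (ex_intro (fun k => stops g (p k)) k pk).
have nstop j : (j < m)%N -> ~~ stops g (p j).
  by apply: contraTN => /m_le; rewrite -leqNgt.
exists m; split=> //.
have [pmd pmq _] := run_invariant _ _ _ g_gtNy g_Lnat m qopt p0d p0q run Xmin nstop.
apply/eqP; rewrite eq_le pmq.
exact: (stops_ge _ _ _ g_gtNy g_Lnat pmd (conj qopt qmin) pm).
Qed.
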